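(* Let $n$ be a positive integer and let $k,l,i,j$ be nonnegative integers. The number of permutations $\sigma\in B_n$ with $\mathrm{wex}_B(\sigma)=k$, $\mathrm{neg}(\sigma)=l$, $\mathrm{cro}_B(\sigma)=i$ and $\mathrm{nes}_B(\sigma)=j$ equals the number of permutations $\sigma\in B_n$ with $\mathrm{wex}_B(\sigma)=k$, $\mathrm{neg}(\sigma)=l$, $\mathrm{nes}_B(\sigma)=i$ and $\mathrm{cro}_B(\sigma)=j$. Equivalently, $$\sum_{\sigma\in B_n}p^{\mathrm{nes}_B(\sigma)}q^{\mathrm{cro}_B(\sigma)}y^{\mathrm{wex}_B(\sigma)}a^{\mathrm{neg}(\sigma)}=\sum_{\sigma\in B_n}p^{\mathrm{cro}_B(\sigma)}q^{\mathrm{nes}_B(\sigma)}y^{\mathrm{wex}_B(\sigma)}a^{\mathrm{neg}(\sigma)}.$$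
   Context: For a positive integer $n$, $[n]=\{1,\dots,n\}$ and $[-n,n]=\{-n,\dots,-1,1,\dots,n\}$, ordered by the natural order of $\mathbb{Z}$. $B_n$ is the set of type $B$ permutations of rank $n$: integer sequences $\sigma=(\sigma(1),\dots,\sigma(n))$ with $\{|\sigma(1)|,\dots,|\sigma(n)|\}=[n]$; $\sigma$ is identified with a permutation of $[-n,n]$ via $\sigma(-i)=-\sigma(i)$. $\mathrm{neg}(\sigma)$ is the number of negative entries among $\sigma(1),\dots,\sigma(n)$. $\mathrm{wex}_B(\sigma)=|\{j\in[n]:\sigma(j)\ge j\}|$. The permutation diagram of $\sigma$ has vertices $-n,\dots,-1,1,\dots,n$ placed left to right on a line and, for each $i\in[-n,n]$, an arc from $i$ to $\sigma(i)$, drawn above the line if $i\le\sigma(i)$ and below otherwise. A crossing of $\sigma$ is a pair of arcs $(i,\sigma(i)),(j,\sigma(j))$, $i,j\in[n]$, satisfying $i<j\le\sigma(i)<\sigma(j)$ (upper crossing), or $-i<j\le\sigma(-i)<\sigma(j)$ (upper crossing), or $\sigma(i)<\sigma(j)<i<j$ (lower crossing). A nesting of $\sigma$ is a pair of arcs $(i,\sigma(i)),(j,\sigma(j))$, $i,j\in[n]$, satisfying $i<j\le\sigma(j)<\sigma(i)$ (upper nesting), or $-i<j\le\sigma(-j)<\sigma(i)$ (upper nesting), or $\sigma(j)<\sigma(i)<i<j$ (lower nesting). $\mathrm{cro}_B(\sigma)$ and $\mathrm{nes}_B(\sigma)$ denote the numbers of crossings and nestings of $\sigma$. (E.g. for $\sigma=(4,-6,3,5,1,-2)$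 the paper counts $\mathrm{nes}_B(\sigma)=5$ and $\mathrm{cro}_B(\sigma)=4$.)
   Formalization: The second upper-nesting condition, given as -i<j≤σ(-j)<σ(i), is corrected to -i<j≤σ(j)<σ(-i); as printed it contradicts the example nes_B=5 and makes the symmetry false for n=3 (wex_B=2, neg=1). *)

(* Defs.v *)
From HB Require Import structures.
From mathcomp Require Import all_boot all_order all_algebra.

Set Implicit Arguments.
Unset Strict Implicit.
Unset Printing Implicit Defensive.

Import Order.TTheory GRing.Theory Num.Theory.
Local Open Scope ring_scope.

Definition is_signed_perm (n : nat) (w : n.-tuple int) : bool :=
  perm_eq [seq `|x|%N | x <- w] (iota 1 n).

(* Since [w] has [n] entries, the multiset equality above is the set equality
   {|w(1)|, ..., |w(n)|} = {1, ..., n}. *)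
Lemma is_signed_permP (n : nat) (w : n.-tuple int) :
  reflect ([seq `|x|%N | x <- w] =i iota 1 n) (is_signed_perm w).
Proof.
apply: (iffP idP) => [/perm_mem // | eq_w].
have sz : size [seq `|x|%N | x <- w] = size (iota 1 n).
  by rewrite size_map size_tuple size_iota.
apply: uniq_perm => //; last exact: iota_uniq.
apply: (@leq_size_uniq _ (iota 1 n)); first exact: iota_uniq.
  by move=> x; rewrite eq_w.
by rewrite sz.
Qed.

(* B_n *)
Record signed_perm (n : nat) := SignedPerm {
  word : n.-tuple int;
  wordP : is_signed_perm word }.

HB.instance Definition _ (n : nat) := [isSub for @word n].
HB.instance Definition _ (n : nat) := [Countable of signed_perm n by <:].

Definition signed_perm_encode (n : nat) (s : signed_perm n) : n.-tuple (bool * 'I_n.+1) :=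
  [tuple of [seq (x < 0, inord `|x|%N) | x <- word s]].

Definition signed_perm_decode (n : nat) (t : n.-tuple (bool * 'I_n.+1)) :
    option (signed_perm n) :=
  insub [tuple of [seq (-1) ^+ b.1 * (b.2 : nat)%:Z | b : bool * 'I_n.+1 <- t]].

Lemma signed_perm_encodeK (n : nat) :
  pcancel (@signed_perm_encode n) (@signed_perm_decode n).
Proof.
move=> s; rewrite /signed_perm_decode /signed_perm_encode.
rewrite [X in insub X](_ : _ = word s) ?valK //.
apply/val_inj; rewrite /= -map_comp; apply: map_id_in => x xs /=.
have : `|x|%N \in iota 1 n.
  by rewrite -(perm_mem (wordP s)) map_f.
rewrite mem_iota add1n => /andP[_ ltxn].
by rewrite inordK // abszE mulr_sign_norm.
Qed.

HB.instance Definition _ (n : nat) : isFinite (signed_perm n) :=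
  PCanIsFinite (@signed_perm_encodeK n).

(* The permutation of {-n, ..., -1, 1, ..., n} induced by s, with
   s(-i) = - s(i); [Negz m] is -(m+1). Values outside this set are junk. *)
Definition signed_perm_fun (n : nat) (s : signed_perm n) (i : int) : int :=
  match i with
  | Posz 0 => 0
  | Posz m.+1 => nth 0 (word s) m
  | Negz m => - nth 0 (word s) m
  end.

Coercion signed_perm_fun : signed_perm >-> Funclass.

(* 'I_n is {0, ..., n-1}; [pos i] is the corresponding element of {1, ..., n}. *)
Definition pos (n : nat) (i : 'I_n) : int := i.+1%:Z.

Definition negB (n : nat) (s : signed_perm n) : nat :=
  #|[set j : 'I_n | s (pos j) < 0]|.

Definition wexB (n : nat) (s : signed_perm n) : nat :=
  #|[set j : 'I_n | pos j <= s (pos j)]|.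

Definition crossing (n : nat) (s : signed_perm n) (i j : int) : bool :=
  [|| [&& i < j, j <= s i & s i < s j],
      [&& - i < j, j <= s (- i) & s (- i) < s j]
    | [&& s i < s j, s j < i & i < j]].

(* In the second clause the upper arc (j, s(j)) lies under the upper arc
   (-i, s(-i)). The form -i < j <= s(-j) < s(i) found in print is a misprint: it
   gives 2 instead of 5 nestings for (4, -6, 3, 5, 1, -2), and it breaks the
   equidistribution of crossings and nestings for n = 3. *)
Definition nesting (n : nat) (s : signed_perm n) (i j : int) : bool :=
  [|| [&& i < j, j <= s j & s j < s i],
      [&& - i < j, j <= s j & s j < s (- i)]
    | [&& s j < s i, s i < i & i < j]].

(* The clauses defining a crossing (resp. a nesting) are mutually exclusive and
   determine the roles of the two arcs, so counting ordered pairs (i, j) counts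
   each crossing (resp. nesting) once. *)
Definition croB (n : nat) (s : signed_perm n) : nat :=
  #|[set ij : 'I_n * 'I_n | crossing s (pos ij.1) (pos ij.2)]|.

Definition nesB (n : nat) (s : signed_perm n) : nat :=
  #|[set ij : 'I_n * 'I_n | nesting s (pos ij.1) (pos ij.2)]|.

(* Main.v *)
Require Import Defs.
From mathcomp Require Import all_boot all_order all_algebra.
From mathcomp Require Import zify.

(* Since s(-i) = - s(i), the permutation is determined by the upper arcs of its
   diagram on {-n, ..., -1, 1, ..., n}, and a lower crossing or nesting of
   arcs is one of the mirror images of these arcs, which are upper. The upper
   arcs form a matching of n openers with n closers, where both sets contain
   exactly one of j and -j for each j, and wex_B and neg depend on these two
   sets only: with k positive openers and m positive closers, wex_B = k and
   neg = m - k. For fixed openers and closers, treat the openers from right to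
   left: if h free closers lie to the right of an opener, then choosing the
   (r+1)-st largest creates r nestings and h - 1 - r crossings, and
   h does not depend on the previous choices. Replacing r by h - 1 - r at each
   step exchanges crossings and nestings. *)

Local Open Scope ring_scope.

Set Implicit Arguments.
Unset Strict Implicit.
Unset Printing Implicit Defensive.
Import Order.TTheory GRing.Theory Num.Theory.

(** * Nestings and crossings of words whose letters have lower bounds *)

Section Words.

Variables (d : Order.disp_t) (T : orderType d).
Implicit Types (v t : T) (vs ts V : seq T).
Local Open Scope order_scope.

(* In the next two definitions [vs] lists the closers of a matching by
   decreasing opener, and [ts] lists the smallest closers allowed for these
   openers; nestings are thus the increasing pairs of [vs]. *)
Fixpoint word_nestings vs : nat :=
  if vs is v :: vs' then (count (> v)%O vs' + word_nestings vs')%N else 0%N.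

Fixpoint word_crossings ts vs : nat :=
  match ts, vs with
  | t :: ts', v :: vs' =>
      (count (fun w => t <= w < v)%O vs' + word_crossings ts' vs')%N
  | _, _ => 0%N
  end.

Lemma sort_gt_sorted V : uniq V -> sorted >%O (sort >=%O V).
Proof.
move=> uV; rewrite -[sort _ V]revK rev_sorted lt_sorted_uniq_le.
rewrite rev_uniq sort_uniq uV rev_sorted.
by apply: sort_sorted => x y; rewrite /= orbC le_total.
Qed.

Variables (R : Type) (idx : R) (op : Monoid.com_law idx).

(** In the decreasing arrangement of [V], the entry of index [k] has [k] larger and [size V - k.+1]
    smaller entries. *)
Lemma big_rank (F : nat -> nat -> R) V : uniq V ->
  \big[op/idx]_(v <- V) F (count (> v) V) (count (< v) V)
  = \big[op/idx]_(k < size V) F k (size V - k.+1)%N.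
Proof.
move=> uV; have pV : perm_eq V (sort >=%O V) by rewrite perm_sym perm_sort.
rewrite (perm_big _ pV) (perm_size pV) /=.
under eq_bigr do rewrite !(permP pV).
have := sort_gt_sorted uV.
elim: (sort _ V) F {uV pV} => [|x W IH] F /=; first by rewrite big_nil big_ord0.
rewrite (path_sortedE (rev_trans lt_trans)) => /andP[/allP ltWx sW].
rewrite big_cons big_ord_recl /= subn1 /= ltxx !add0n.
congr (op _ _).
  congr F.
    apply/eqP; rewrite -leqn0 leqNgt -has_count; apply/hasPn => y /ltWx /=.
    by rewrite -leNgt => /ltW.
  by apply/eqP; rewrite -all_count; apply/allP => y /ltWx.
rewrite -(IH (fun a b => F a.+1 b)) //.
rewrite !big_seq; apply: eq_bigr => v vW /=.
by have /= ltvx := ltWx v vW; rewrite ltvx (lt_gtF ltvx).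
Qed.

(* The iterated [op] over the Lehmer codes of the valid words: the next opener
   has [h] closers after it, [k] of which have been taken by later openers.
   Choosing the one with [i] larger free closers creates [i] nestings and
   [h - k - i.+1] crossings. *)
Fixpoint code_big (k : nat) (hs : seq nat) (F : nat -> nat -> R) : R :=
  if hs is h :: hs' then
    \big[op/idx]_(i < h - k)
      code_big k.+1 hs' (fun x y => F (i + x) (h - k - i.+1 + y))%N
  else F 0%N 0%N.

Lemma code_big_ext k hs F F' : F =2 F' -> code_big k hs F = code_big k hs F'.
Proof.
elim: hs k F F' => [|h hs IH] k F F' eF /=; first exact: eF.
by apply: eq_bigr => i _; apply: IH => x y; exact: eF.
Qed.

Lemma code_big_pred k hs F : code_big k (map predn hs) F = code_big k.+1 hs F.
Proof.
elim: hs k F => [|h hs IH] k F //=.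
rewrite (_ : (h.-1 - k = h - k.+1)%N); last by lia.
by apply: eq_bigr => i _; exact: IH.
Qed.

Lemma code_big_sym k hs F :
  code_big k hs F = code_big k hs (fun x y => F y x).
Proof.
elim: hs k F => [|h hs IH] k F //=.
rewrite (reindex_inj rev_ord_inj) /=; apply: eq_bigr => i _.
rewrite IH; apply: code_big_ext => x y.
by congr F; have := ltn_ord i; lia.
Qed.

(** Induction on the first letter [v]: as the thresholds decrease, [v] is counted by every later
    one, so its removal lowers all later counts by one, whichever [v] was chosen. *)
Lemma big_words (F : nat -> nat -> R) ts V :
    sorted >=%O ts -> uniq V -> size V = size ts ->
  \big[op/idx]_(vs <- permutations V | all2 <=%O ts vs)
     F (word_nestings vs) (word_crossings ts vs)
  = code_big 0 [seq count (>= t) V | t <- ts] F.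
Proof.
elim: ts V F => [|t ts IH] V F /=.
  by move=> _ _ /size0nil ->; rewrite big_cons big_nil /= Monoid.mulm1.
rewrite (path_sortedE (rev_trans le_trans)) => /andP[/allP /= letst sts] uV szV.
have V_gt0 : (0 < size V)%N by rewrite szV.
rewrite (perm_big _ (permutationsE V_gt0)) big_mkcond.
rewrite big_allpairs_dep /= undup_id // subn0.
pose H a b := code_big 1 [seq count (>= t) V | t <- ts]
  (fun x y => F (a + x) (b + y))%N.
transitivity (\big[op/idx]_(v <- [seq v <- V | t <= v])
   H (count (> v) [seq v <- V | t <= v]) (count (< v) [seq v <- V | t <= v])).
  rewrite big_filter [RHS]big_mkcond /= 2!big_seq; apply: eq_bigr => v vV.
  case: ifPn => letv; last by rewrite big1 //= => i _; rewrite (negPf letv).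
  rewrite -big_mkcond /=.
  have cR (a : pred T) : ~~ a v -> count a (rem v V) = count a V.
    by move=> nav; rewrite (permP (perm_to_rem vV)) /= (negPf nav).
  have cR1 (a : pred T) : a v -> count a (rem v V) = (count a V).-1.
    by move=> av; rewrite (permP (perm_to_rem vV)) /= av.
  pose F' x y :=
    F (count (> v)%O V + x)%N (count (fun w => t <= w < v)%O V + y)%N.
  transitivity (\big[op/idx]_(w <- permutations (rem v V) | all2 <=%O ts w)
     F' (word_nestings w) (word_crossings ts w)).
    rewrite big_seq_cond [RHS]big_seq_cond; apply: eq_bigr => w /andP[].
    rewrite mem_permutations => /permP pw _.
    (* Neither predicate counted here holds at [v] itself, so counting in [rem v V] or in [V]
       agrees. *)
    by rewrite /F' !pw !cR //= ?ltxx ?andbF.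
  rewrite IH ?rem_uniq ?size_rem ?szV // /H -code_big_pred -map_comp.
  have /eq_in_map -> :
      {in ts, (fun t => count (>= t) (rem v V))
              =1 predn \o (fun t => count (>= t) V)}.
    by move=> t' /letst let't /=; rewrite cR1 // (le_trans let't).
  apply: code_big_ext => x y; rewrite /F' !count_filter.
  congr (F (_ + x) (_ + y))%N; apply: eq_count => w /=; last by rewrite andbC.
  by case: (ltP v w) => //= /ltW /(le_trans letv).
rewrite big_rank ?filter_uniq // size_filter.
by apply: eq_bigr.
Qed.

Lemma big_words_sym (F : nat -> nat -> R) ts V :
    sorted >=%O ts -> uniq V -> size V = size ts ->
  \big[op/idx]_(vs <- permutations V | all2 <=%O ts vs)
     F (word_nestings vs) (word_crossings ts vs)
  = \big[op/idx]_(vs <- permutations V | all2 <=%O ts vs)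
     F (word_crossings ts vs) (word_nestings vs).
Proof.
move=> sts uV szV; rewrite big_words // code_big_sym.
by rewrite -(big_words (fun x y => F y x)).
Qed.

(** * Word statistics as sums over pairs of openers *)

Lemma word_nestings_sum (f : T -> T) us : sorted >%O us ->
  word_nestings (map f us)
  = (\sum_(u <- us) \sum_(w <- us) ((w < u)%O && (f u < f w)%O))%N.
Proof.
elim: us => [|u us IH] /=; first by rewrite big_nil.
rewrite (path_sortedE (rev_trans lt_trans)) => /andP[/allP /= ltu sus].
rewrite !big_cons ltxx /= add0n count_map -sum1_count big_mkcond IH //.
congr addn.
  rewrite !big_seq; apply: eq_bigr => w /ltu -> /=.
  by case: ifP => // ->.
rewrite !big_seq; apply: eq_bigr => w /ltu ltwu.
by rewrite big_cons (lt_gtF ltwu).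
Qed.

Lemma word_crossings_sum (g f : T -> T) us : sorted >%O us ->
  word_crossings (map g us) (map f us)
  = (\sum_(u <- us) \sum_(w <- us) ((w < u)%O && (g u <= f w < f u)%O))%N.
Proof.
elim: us => [|u us IH] /=; first by rewrite big_nil.
rewrite (path_sortedE (rev_trans lt_trans)) => /andP[/allP /= ltu sus].
rewrite !big_cons ltxx /= add0n count_map -sum1_count big_mkcond IH //.
congr addn.
  rewrite !big_seq; apply: eq_bigr => w /ltu -> /=.
  by case: ifP => // ->.
rewrite !big_seq; apply: eq_bigr => w /ltu ltwu.
by rewrite big_cons (lt_gtF ltwu).
Qed.

End Words.

(** * Choices of one point from each pair of opposite points *)

Section SignedPermutations.

Variable n : nat.
Implicit Types (s : signed_perm n) (P : {set 'I_n}) (i j : 'I_n).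

Definition signed P j : int := if j \in P then pos j else - pos j.

Definition transversal P : seq int := [seq signed P j | j <- enum 'I_n].

Lemma pos_gt0 j : 0 < pos j. Proof. by []. Qed.

Lemma pos_inj : injective (@pos n).
Proof. by move=> i j [/val_inj]. Qed.

Lemma abs_transversal P : map absz (transversal P) = iota 1 n.
Proof.
rewrite -map_comp (iotaDl 1 0) -val_enum_ord -map_comp.
by apply: eq_map => j /=; rewrite /signed; case: ifP => _; rewrite ?abszN.
Qed.

Lemma size_transversal P : size (transversal P) = n.
Proof. by rewrite size_map size_enum_ord. Qed.

Lemma transversal_uniq P : uniq (transversal P).
Proof. by apply: (@map_uniq _ _ absz); rewrite abs_transversal iota_uniq. Qed.

Lemma mem_transversal P j : (pos j \in transversal P) = (j \in P).
Proof.
apply/mapP/idP => [[i _]|jP]; last first.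
  by exists j; rewrite ?mem_enum // /signed jP.
rewrite /signed; case: ifP => [iP /pos_inj -> //|_ E].
by have := pos_gt0 i; have := pos_gt0 j; lia.
Qed.

(** As [absz] is injective on [X], opposite points do not both occur in it; an inclusion between
    duplicate-free lists of size [n] then suffices. *)
Lemma perm_transversal (X : seq int) : perm_eq (map absz X) (iota 1 n) ->
  perm_eq X (transversal [set j | pos j \in X]).
Proof.
move=> pX; have uX : uniq (map absz X) by rewrite (perm_uniq pX) iota_uniq.
have sX : size X = n by rewrite -(size_map absz) (perm_size pX) size_iota.
apply: uniq_perm; rewrite ?transversal_uniq ?(map_uniq uX) //.
apply: (uniq_min_size (map_uniq uX) _ _).2; last by rewrite size_transversal sX.
move=> /= x xX.
have : absz x \in iota 1 n by rewrite -(perm_mem pX) map_f.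
rewrite mem_iota => /andP[x_gt0 ltxn].
have ltj : ((absz x).-1 < n)%N by lia.
pose j := Ordinal ltj.
apply/mapP; exists j; first by rewrite mem_enum.
rewrite /signed inE; have [x_ge0|x_lt0] := lerP 0 x.
  by have <- : x = pos j; rewrite ?xX // /pos /=; lia.
have Ex : x = - pos j by rewrite /pos /=; lia.
case: ifP => // jX; suff : x = pos j by [].
apply/eqP; rewrite -(nth_index 0 xX) -(nth_index 0 jX).
rewrite nth_uniq ?index_mem ?(map_uniq uX) //.
rewrite -(nth_uniq 0%N _ _ uX) ?size_map ?index_mem //.
by rewrite !(nth_map 0) ?index_mem // !nth_index // Ex abszN.
Qed.

Lemma signed_permN s (x : int) : s (- x) = - s x.
Proof. by case: x => [[|m]|m] //=; rewrite ?oppr0 ?opprK. Qed.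

Lemma signed_perm_pos s j : s (pos j) = nth 0 (word s) j.
Proof. by []. Qed.

Lemma map_word s : [seq s (pos j) | j <- enum 'I_n] = word s.
Proof.
rewrite (eq_map (signed_perm_pos s)) (map_comp (nth 0 (word s)) val).
rewrite val_enum_ord -[in iota _ _](size_tuple (word s)).
by rewrite map_nth_iota0 // take_size.
Qed.

Local Arguments signed_perm_fun : simpl never.
Local Arguments pos : simpl never.

Lemma abs_image s P : perm_eq (map absz (map s (transversal P))) (iota 1 n).
Proof.
suff -> : map absz (map s (transversal P)) = map absz (word s) by exact: wordP.
rewrite -map_word -!map_comp; apply: eq_map => j /=.
by rewrite /signed; case: ifP => _ //; rewrite signed_permN abszN.
Qed.

(** * Encoding by openers and closers *)

Definition exceedances s : {set 'I_n} := [set j | pos j <= s (pos j)].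

(* The [u]'s in [transversal (exceedances s)] are the points with [u <= s u]
   (except the negative fixed points), i.e. the starts of the upper arcs. *)
Definition closers s : {set 'I_n} :=
  [set j | pos j \in map s (transversal (exceedances s))].

Lemma perm_closers s :
  perm_eq (map s (transversal (exceedances s))) (transversal (closers s)).
Proof. exact/perm_transversal/abs_image. Qed.

Lemma count_enum (a : pred 'I_n) : count a (enum 'I_n) = #|[set j | a j]|.
Proof.
by rewrite -sum1_count big_enum_cond sum1dep_card.
Qed.

(** Each exceedance yields a positive closer; any other [j] yields the closer [- s (pos j)],
    positive exactly when [s (pos j) < 0]. *)
Lemma negB_closers s : negB s = (#|closers s| - #|exceedances s|)%N.
Proof.
have -> : #|closers s| = count (> 0) (transversal (closers s)).
  rewrite count_map count_enum; apply: eq_card => j.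
  by rewrite [RHS]inE /= /signed; case: ifP.
rewrite -(permP (perm_closers s)) -map_comp count_map count_enum.
rewrite (_ : finset _ = exceedances s :|: [set j | s (pos j) < 0]).
  rewrite cardsU [_ :&: _](_ : _ = set0) ?cards0 ?subn0 ?addKn //.
  by apply/setP=> j; rewrite !inE; have := pos_gt0 j; lia.
apply/setP=> j; rewrite !inE /= /signed inE.
case: ifP => [|_]; last by rewrite signed_permN; lia.
by have := pos_gt0 j; lia.
Qed.

Definition openers P : seq int := sort >=%O (transversal P).

(* The closer [v] may be matched with the opener [u] iff [threshold u <= v]:
   an arc may be a loop at a positive point but not at a negative one, since
   only the positive one of the two loops [(j, j)] and [(-j, -j)] is upper. *)
Definition threshold (u : int) : int := u + ((u < 0)%R : nat)%:Z.

Lemma threshold_signed s j :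
  threshold (signed (exceedances s) j) <= s (signed (exceedances s) j).
Proof.
rewrite /threshold /signed inE; have j_gt0 := pos_gt0 j.
have [Ej|] := lerP (pos j) (s (pos j)); first lia.
by rewrite signed_permN; lia.
Qed.

Definition closing_word s : seq int := map s (openers (exceedances s)).

Definition thresholds P : seq int := map threshold (openers P).

Lemma openers_gt_sorted P : sorted >%O (openers P).
Proof. exact/sort_gt_sorted/transversal_uniq. Qed.

Lemma perm_openers P : perm_eq (openers P) (transversal P).
Proof. by rewrite perm_sort. Qed.

Lemma thresholds_sorted P : sorted >=%O (thresholds P).
Proof.
rewrite sorted_map; apply: sub_sorted (openers_gt_sorted P) => x y.
by rewrite /threshold /=; lia.
Qed.

Lemma sum_openers P (F : int -> int -> nat) :
  (\sum_(u <- openers P) \sum_(w <- openers P) F u w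
   = \sum_i \sum_j F (signed P i) (signed P j))%N.
Proof.
rewrite (perm_big _ (perm_openers P)) big_map big_enum; apply: eq_bigr => i _.
by rewrite (perm_big _ (perm_openers P)) big_map big_enum.
Qed.

Lemma card_pairs (r : rel 'I_n) :
  #|[set ij : 'I_n * 'I_n | r ij.1 ij.2]| = (\sum_i \sum_j r i j)%N.
Proof.
rewrite pair_big -sum1_card big_mkcond; apply: eq_bigr => -[i j] _.
by rewrite inE.
Qed.

(* The condition on [(i, j)] attached to a pair of lower arcs is the one on
   the upper arcs starting from [- j] and [- i], whence the exchange of the
   roles of the two indices. *)
Lemma sum_exchange_lower P (r : rel 'I_n) :
  (\sum_i \sum_j (((j \in P) && r j i : nat) + ((i \notin P) && r i j : nat))
   = \sum_i \sum_j r i j)%N.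
Proof.
under eq_bigr do rewrite big_split.
rewrite big_split /= exchange_big -big_split; apply: eq_bigr => j _ /=.
rewrite -big_split; apply: eq_bigr => i _ /=.
by case: (j \in P); rewrite ?addn0.
Qed.

Lemma croB_word s :
  croB s = word_crossings (thresholds (exceedances s)) (closing_word s).
Proof.
rewrite word_crossings_sum ?openers_gt_sorted // sum_openers /croB.
rewrite (card_pairs (fun i j => crossing s (pos i) (pos j))).
set E := exceedances s.
(* The right opener belongs to [j]. If it is positive, [T j i] is one of the two upper clauses,
   according to the sign of the left opener; if it is negative, so is the left one, and the mirror
   images of the arcs satisfy the lower clause. *)
pose T j i := (signed E i < signed E j) &&
  (threshold (signed E j) <= s (signed E i) < s (signed E j)).
rewrite -(sum_exchange_lower E T).
apply: eq_bigr => i _; apply: eq_bigr => j _.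
rewrite /crossing /T /threshold /signed !inE.
have := pos_gt0 i; have := pos_gt0 j.
by case: ifP => iE; case: ifP => jE; rewrite !signed_permN; lia.
Qed.

Lemma nesB_word s : nesB s = word_nestings (closing_word s).
Proof.
rewrite word_nestings_sum ?openers_gt_sorted // sum_openers /nesB.
rewrite (card_pairs (fun i j => nesting s (pos i) (pos j))).
set E := exceedances s.
pose T j i := (signed E i < signed E j) && (s (signed E j) < s (signed E i)).
rewrite -(sum_exchange_lower E T).
apply: eq_bigr => i _; apply: eq_bigr => j _.
rewrite /nesting /T /signed !inE.
have := pos_gt0 i; have := pos_gt0 j.
by case: ifP => iE; case: ifP => jE; rewrite !signed_permN; lia.
Qed.

Lemma mem_openers P j : signed P j \in openers P.
Proof. by rewrite (perm_mem (perm_openers P)) map_f ?mem_enum. Qed.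

Lemma signed_perm_ext P s1 s2 :
  {in openers P, s1 =1 s2} -> s1 = s2.
Proof.
move=> eqs; apply/val_inj/val_inj; rewrite /= -!map_word.
apply: eq_map => j; have := eqs _ (mem_openers P j).
by rewrite /signed; case: ifP => // _; rewrite !signed_permN => /oppr_inj.
Qed.

Lemma closing_word_exists P Q (vs : seq int) :
    perm_eq vs (transversal Q) -> all2 <=%O (thresholds P) vs ->
  exists s, [/\ exceedances s = P, closers s = Q & map s (openers P) = vs].
Proof.
move=> pvs lets; pose f u := nth 0 vs (index u (openers P)).
have uO : uniq (openers P).
  by rewrite (perm_uniq (perm_openers P)) transversal_uniq.
have sz : size (openers P) = size vs.
  by rewrite (perm_size pvs) (perm_size (perm_openers P)) !size_transversal.
have mapf : map f (openers P) = vs.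
  apply: (@eq_from_nth _ 0) => [|i]; rewrite size_map // => lti.
  by rewrite (nth_map 0) // /f index_uniq.
(* The odd extension of [f] from the openers to all points. *)
pose w := [tuple (if j \in P then f (pos j) else - f (- pos j)) | j < n].
have wP : is_signed_perm w.
  rewrite /is_signed_perm -(abs_transversal Q).
  rewrite -(permPr (perm_map absz pvs)) -mapf.
  rewrite (permPr (perm_map absz (perm_map f (perm_openers P)))).
  rewrite /transversal -val_ord_tuple -!map_comp.
  rewrite (@eq_map _ _ _ (absz \o (f \o signed P))) //.
  by move=> j /=; rewrite /signed; case: ifP => // _; rewrite abszN.
pose s := SignedPerm wP.
have sE j : s (signed P j) = f (signed P j).
  have sj : s (pos j) = if j \in P then f (pos j) else - f (- pos j).
    by rewrite signed_perm_pos -tnth_nth tnth_mktuple.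
  by rewrite /signed; case: ifP sj => _ sj; rewrite ?signed_permN sj ?opprK.
have sO : map s (openers P) = vs.
  rewrite -mapf; apply/eq_in_map => u; rewrite (perm_mem (perm_openers P)).
  by case/mapP => j _ ->.
have exP : exceedances s = P.
  have : all2 (fun u v => threshold u <= v) (openers P) (map s (openers P)).
    move: lets; rewrite -sO /thresholds.
    by elim: (openers P) => //= u us IH /andP[-> /IH].
  have -> us : all2 (fun u v => threshold u <= v) us (map s us)
               = all (fun u => threshold u <= s u) us.
    by elim: us => //= u us ->.
  (* At a negative opener [- pos j], the threshold [- pos j + 1] forces [s (pos j) < pos j], so [j]
     is not an exceedance. *)
  move=> /allP les; apply/setP=> j; rewrite inE.
  have := les _ (mem_openers P j); rewrite /threshold /signed.
  by have := pos_gt0 j; case: ifP => _; rewrite ?signed_permN; lia.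
exists s; split=> //; apply/setP=> j.
rewrite inE exP -(perm_mem (perm_map s (perm_openers P))) sO (perm_mem pvs).
exact: mem_transversal.
Qed.

Variables (R : Type) (idx : R) (op : Monoid.com_law idx).

(** Taking closing words is a bijection from the fiber onto the arrangements of [transversal Q] that
    respect the thresholds. *)
Lemma big_fiber P Q (H : nat -> nat -> R) :
  \big[op/idx]_(s | (exceedances s == P) && (closers s == Q))
     H (nesB s) (croB s)
  = \big[op/idx]_(vs <- permutations (transversal Q)
                   | all2 <=%O (thresholds P) vs)
     H (word_nestings vs) (word_crossings (thresholds P) vs).
Proof.
pose A := [set s | (exceedances s == P) && (closers s == Q)].
transitivity (\big[op/idx]_(vs <- [seq map s (openers P) | s in A])
     H (word_nestings vs) (word_crossings (thresholds P) vs)).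
  rewrite big_map big_enum; apply: eq_big => s; first by rewrite inE.
  by case/andP=> /eqP <- _; rewrite croB_word nesB_word.
rewrite -[RHS]big_filter; apply: perm_big; apply: uniq_perm.
- rewrite map_inj_in_uniq ?enum_uniq // => s1 s2 _ _ /eq_in_map.
  exact: signed_perm_ext.
- by rewrite filter_uniq ?permutations_uniq.
move=> vs; rewrite mem_filter mem_permutations; apply/imageP/andP.
  case=> s; rewrite inE => /andP[/eqP <- /eqP <-] ->; split.
    rewrite /thresholds; set us := openers _.
    have : {in us, forall u, threshold u <= s u}.
      move=> u; rewrite (perm_mem (perm_openers _)) => /mapP[j _ ->].
      exact: threshold_signed.
    by move/allP; elim: us => //= u us IH /andP[-> /IH].
  by rewrite -(permPr (perm_closers s)) perm_map // perm_openers.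
case=> lets pvs; have [s [sP sQ svs]] := closing_word_exists pvs lets.
by exists s; rewrite ?inE ?sP ?sQ ?eqxx.
Qed.

(** A general commutative monoid law serves both the counting form and the polynomial form. *)
Lemma big_cro_nes_sym (H : nat -> nat -> nat -> nat -> R) :
  \big[op/idx]_(s : signed_perm n) H (nesB s) (croB s) (wexB s) (negB s)
  = \big[op/idx]_(s : signed_perm n) H (croB s) (nesB s) (wexB s) (negB s).
Proof.
pose D s := (exceedances s, closers s).
rewrite (partition_big D xpredT) // [RHS](partition_big D xpredT) //.
apply: eq_bigr => -[P Q] _.
(* [wexB s] is by definition the cardinal of [exceedances s], so [wexB] and [negB] are constant on
   the fiber. *)
pose H' x y := H x y #|P| (#|Q| - #|P|)%N.
transitivity (\big[op/idx]_(s | (exceedances s == P) && (closers s == Q))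
  H' (nesB s) (croB s)).
  apply: eq_big => // s /andP[_ /eqP[sP sQ]].
  by rewrite negB_closers /H' -sP -sQ.
transitivity (\big[op/idx]_(s | (exceedances s == P) && (closers s == Q))
  H' (croB s) (nesB s)); last first.
  apply: eq_big => // s /andP[/eqP sP /eqP sQ].
  by rewrite negB_closers /H' -sP -sQ.
rewrite big_fiber (big_fiber P Q (fun x y => H' y x)).
apply: big_words_sym; rewrite ?thresholds_sorted ?transversal_uniq //.
by rewrite [RHS]size_map (perm_size (perm_openers P)) !size_transversal.
Qed.

End SignedPermutations.

Unset Implicit Arguments.

Theorem theorem2p4 (n : nat) (n_gt0 : (0 < n)%N) :
  (forall k l i j : nat,
     #|[set s : signed_perm n | [&& wexB s == k, negB s == l,
                                    croB s == i & nesB s == j]]|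
     = #|[set s : signed_perm n | [&& wexB s == k, negB s == l,
                                      nesB s == i & croB s == j]]|)
  /\
  (forall (R : comNzRingType) (p q y a : R),
     \sum_(s : signed_perm n)
        p ^+ nesB s * q ^+ croB s * y ^+ wexB s * a ^+ negB s
     = \sum_(s : signed_perm n)
        p ^+ croB s * q ^+ nesB s * y ^+ wexB s * a ^+ negB s).
Proof.
split=> [k l i j | R p q y a].
  rewrite -!sum1dep_card big_mkcond [RHS]big_mkcond.
  exact: (big_cro_nes_sym n addn (fun x y w m =>
    if [&& w == k, m == l, y == i & x == j] then 1 else 0)%N).
exact: (big_cro_nes_sym n +%R
  (fun x z w m => p ^+ x * q ^+ z * y ^+ w * a ^+ m)).
Qed.
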